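(* Let $U$ be a fixed set and let $\mathcal{F}_A$, $\mathcal{G}_B$ be soft sets over $U$. A soft morphism $\alpha:\mathcal{F}_A\to\mathcal{G}_B$ is a monomorphism in the category $\mathbf{Sset(U)}$ if and only if $\alpha$ is injective (as a function $A\to B$).
   Context: Let $U$ be a fixed universal set. A soft set $\mathcal{F}_A$ over $U$ consists of a set $A$ (the parameter set, an arbitrary set, possibly empty) together with a function $\mathcal{F}:A\to\mathcal{P}(U)$, where $\mathcal{P}(U)$ is the power set of $U$. A soft morphism from a soft set $\mathcal{F}_A$ to a soft set $\mathcal{G}_B$ is a function $\alpha:A\to B$ such that $\mathcal{F}(a)\subseteq(\mathcal{G}\circ\alpha)(a)$ for each $a\in A$; formally it is regarded as the triple $(\mathcal{F}_A,\alpha,\mathcal{G}_B)$. Composition is composition of functions and the identity soft morphism is the identity function. $\mathbf{Sset(U)}$ is the category whose objects are all soft sets over $U$ and whose morphisms are the soft morphisms. A morphism $f:X\to Y$ of a category is a monomorphism if for all pairs of morphisms $h,k:Z\to X$, $f\circ h=f\circ k$ implies $h=k$. *)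

(* Defs.v *)
From mathcomp Require Import all_boot.
From mathcomp Require Import boolp classical_sets.

Set Implicit Arguments.
Unset Strict Implicit.
Unset Printing Implicit Defensive.

Local Open Scope classical_set_scope.

Record category := Category {
  obj :> Type;
  hom : obj -> obj -> Type;
  idmor : forall X : obj, hom X X;
  compmor : forall X Y Z : obj, hom Y Z -> hom X Y -> hom X Z;
  comp1m : forall (X Y : obj) (f : hom X Y), compmor (idmor Y) f = f;
  compm1 : forall (X Y : obj) (f : hom X Y), compmor f (idmor X) = f;
  compA : forall (W X Y Z : obj) (h : hom Y Z) (g : hom X Y) (f : hom W X),
    compmor h (compmor g f) = compmor (compmor h g) f
}.

Definition monomorphism (C : category) (X Y : C) (f : hom X Y) : Prop :=
  forall (Z : C) (h k : hom Z X), compmor f h = compmor f k -> h = k.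

Arguments monomorphism C {X Y} f.

Record softSet (U : Type) := SoftSet {
  param : Type;
  approx :> param -> set U
}.

(* Source and target are carried by the type, so equality of morphisms is    *)
(* equality of triples (source, function, target).                           *)
Record softMorphism (U : Type) (F G : softSet U) := SoftMorphism {
  soft_fun :> param F -> param G;
  soft_sub : forall a : param F, F a `<=` G (soft_fun a)
}.

Lemma softMorphism_eq (U : Type) (F G : softSet U) (f g : softMorphism F G) :
  soft_fun f = soft_fun g -> f = g.
Proof.
case: f g => [f fP] [g gP] /= fg; case: _ / fg gP => gP.
by congr SoftMorphism; exact: Prop_irrelevance.
Qed.

Definition soft_id (U : Type) (F : softSet U) : softMorphism F F :=
  @SoftMorphism U F F id (fun a => @subset_refl U (F a)).

Definition soft_comp (U : Type) (F G H : softSet U)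
    (g : softMorphism G H) (f : softMorphism F G) : softMorphism F H :=
  @SoftMorphism U F H (soft_fun g \o soft_fun f)
    (fun a => subset_trans (soft_sub f (a := a)) (soft_sub g (a := f a))).

Lemma soft_comp1m (U : Type) (F G : softSet U) (f : softMorphism F G) :
  soft_comp (soft_id G) f = f.
Proof. exact: softMorphism_eq. Qed.

Lemma soft_compm1 (U : Type) (F G : softSet U) (f : softMorphism F G) :
  soft_comp f (soft_id F) = f.
Proof. exact: softMorphism_eq. Qed.

Lemma soft_compA (U : Type) (E F G H : softSet U) (h : softMorphism G H)
    (g : softMorphism F G) (f : softMorphism E F) :
  soft_comp h (soft_comp g f) = soft_comp (soft_comp h g) f.
Proof. exact: softMorphism_eq. Qed.

Definition Sset (U : Type) : category :=
  Category (@soft_comp1m U) (@soft_compm1 U) (@soft_compA U).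

(* Main.v *)
(* A parameter of F is the same thing as a soft morphism into F from the      *)
(* one-parameter soft set whose only value is the empty set, so such points   *)
(* test injectivity.                                                          *)
Require Import Defs.
From mathcomp Require Import all_boot.
From mathcomp Require Import boolp classical_sets.

(** If [alpha] identifies [a] and [b], it also identifies the two points they name, so a
    monomorphism forces [a = b]. Conversely, an injective function cancels on the left pointwise. *)

Definition soft_point (U : Type) : softSet U :=
  @SoftSet U unit (fun=> set0).

(** The value [set0] lies in every [F a], so each parameter gives a point. *)
Definition soft_point_mor (U : Type) (F : softSet U) (a : param F) :
    softMorphism (soft_point U) F :=
  @SoftMorphism U (soft_point U) F (fun=> a) (fun=> @sub0set U (F a)).

Theorem theorem7 (U : Type) (F G : softSet U) (alpha : softMorphism F G) :
  monomorphism (Sset U) alpha <-> injective (soft_fun alpha).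
Proof.
split=> [mono a b eq_ab | inj Z h k eq_hk].
  have eq_points : soft_point_mor U F a = soft_point_mor U F b.
    apply: (mono (soft_point U)); apply: softMorphism_eq.
    by apply/funext => -[] /=.
  (* Evaluating at [tt] recovers the parameter from its point. *)
  exact: (congr1 (fun f : softMorphism (soft_point U) F => soft_fun f tt) eq_points).
apply: softMorphism_eq; apply/funext => z; apply: inj.
exact: (congr1 (fun f : softMorphism Z G => soft_fun f z) eq_hk).
Qed.
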